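(* Let $G$ be a finite group, let $(\{\mathfrak{S}^{A}\}_A,\{\mathfrak{O}^{A\to B}\}_{A,B})$ be a resource theory satisfying tensor closure, ancilla preparation, closure under discarding and convexity, and compatible with the symmetry $(G,\{U^A\}_A)$. Let $\rho$ be a state on a system $A$ and $\sigma$ a state on a system $B$, with symmetry actions $\mathcal{U}_g$ and $\mathcal{U}'_g$ respectively. Let $K$ be a subgroup of $G$ and $r>0$. Suppose there exists a sequence of free operations $\mathcal{E}^{(n)}\in\mathfrak{O}^{A^{\otimes n}\to B^{\otimes\lfloor rn\rfloor}}$, $n\in\mathbb{N}$, such that $$\lim_{n\to\infty}\frac{1}{|K|}\sum_{k\in K}\mathrm{T}\Big(\mathcal{E}^{(n)}\big(\mathcal{U}_k(\rho)^{\otimes n}\big),\,\mathcal{U}'_k(\sigma)^{\otimes\lfloor rn\rfloor}\Big)=0,$$ and suppose there exists a sequence of control-admissible sub-POVMs $\{M^{(l)}_x\}_{x\in G/K}$ on $A^{\otimes l}$, $l\in\mathbb{N}$, such that $$\lim_{l\to\infty}\frac{1}{|G|}\sum_{g\in G}\mathrm{tr}\Big(M^{(l)}_{gK}\,\mathcal{U}_g(\rho)^{\otimes l}\Big)=1.$$ Then $R_{G\text{-}\mathrm{cov},\mathfrak{O}}(\rho\to\sigma)\ge r$.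
   Context: All systems are finite-dimensional. A resource theory consists of, for each system $A$, a set $\mathfrak{S}^A$ of (free) states and, for each pair of systems, a set $\mathfrak{O}^{A\to B}$ of (free) CPTP maps such that free operations map free states to free states, identity channels are free, and compositions of free operations are free. Further standing assumptions: (tensor closure) tensor products of free states are free and tensor products of free operations are free; (ancilla preparation) for every $\sigma\in\mathfrak{S}^X$ the map $\rho\mapsto\rho\otimes\sigma$ is in $\mathfrak{O}^{A\to AX}$; (closure under discarding) $\mathrm{tr}_X\in\mathfrak{O}^{AX\to A}$; (convexity) each $\mathfrak{O}^{A\to B}$ is convex. Every system $A$ carries a projective unitary representation $U^A$ of $G$, with $\mathcal{U}^A_g(\cdot)=U^A(g)\cdot U^A(g)^\dagger$; composite systems (in particular $A^{\otimes n}$) carry tensor-product representations. The theory is compatible with the symmetry if $\mathcal{U}^A_g(\mathfrak{S}^A)=\mathfrak{S}^A$ and $\mathcal{U}^B_g\circ\mathfrak{O}^{A\to B}\circ\mathcal{U}^A_{g^{-1}}=\mathfrak{O}^{A\to B}$ for all $g\in G$ and all $A,B$. A map $\mathcal{E}:A\to B$ is $G$-covariant if $\mathcal{E}\circ\mathcal{U}^A_g=\mathcal{U}^B_g\circ\mathcal{E}$ for all $g\in G$. A sub-POVM is a finite family of positive semidefinite operators $\{M_x\}_{x\in X_0}$ with $\sum_xM_x\le I$; put $M_\perp:=I-\sum_{x}M_x$. A sub-POVM on a system $Q$ is control-admissible if for all systems $B',C'$ and all free operations $\mathcal{E}_x\in\mathfrak{O}^{B'\to C'}$, $x\in X_0\cup\{\perp\}$,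 the map $L\mapsto\sum_{x\in X_0\cup\{\perp\}}\mathcal{E}_x(\mathrm{tr}_Q((M_x\otimes I_{B'})L))$ is in $\mathfrak{O}^{QB'\to C'}$. $\mathrm{T}(\rho,\sigma)=\frac12\|\rho-\sigma\|_1$. $R_{G\text{-}\mathrm{cov},\mathfrak{O}}(\rho\to\sigma)$ is the supremum of all $r\ge0$ for which there is a sequence of $G$-covariant free operations $\mathcal{F}^{(n)}\in\mathfrak{O}^{A^{\otimes n}\to B^{\otimes\lfloor rn\rfloor}}$ with $\lim_{n\to\infty}\mathrm{T}(\mathcal{F}^{(n)}(\rho^{\otimes n}),\sigma^{\otimes\lfloor rn\rfloor})=0$. *)

(* Defs.v *)
(* MathComp / MathComp-Analysis; complex scalars are R[i] for R : realType. *)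
From HB Require Import structures.
From mathcomp Require Import all_boot all_order all_algebra all_fingroup.
From mathcomp Require Import spectral sesquilinear.
From mathcomp Require Import all_classical all_reals all_analysis.
From mathcomp Require Import complex mxtens.

Set Implicit Arguments.
Unset Strict Implicit.
Unset Printing Implicit Defensive.

Import Order.TTheory GRing.Theory Num.Theory.
Import numFieldNormedType.Exports.

Local Open Scope classical_set_scope.
Local Open Scope complex_scope.
Local Open Scope sesquilinear_scope.
Local Open Scope ring_scope.

Section Matrices.
Variable R : realType.
Local Notation C := R[i].

Definition psdmx n (X : 'M[C]_n) : Prop :=
  X \is hermsymmx /\ forall v : 'rV[C]_n, 0 <= (v *m X *m v^t*) 0 0.

Definition is_state n (X : 'M[C]_n) : Prop := psdmx X /\ \tr X = 1.

(* Sum of the singular values of X. The eigenvalues of X^t* *m X are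
   nonnegative reals, so taking real parts loses nothing. *)
Definition trace_norm n (X : 'M[C]_n) : R :=
  \sum_(i < n) Num.sqrt (complex.Re (spectral_diag (X^t* *m X) 0 i)).

Definition trace_dist n (X Y : 'M[C]_n) : R := 2^-1 * trace_norm (X - Y).

Definition ptrace1 m n (L : 'M[C]_(m * n)) : 'M[C]_n :=
  \matrix_(i, j) \sum_(k < m) L (mxtens_index (k, i)) (mxtens_index (k, j)).

Definition ptrace2 m n (L : 'M[C]_(m * n)) : 'M[C]_m :=
  \matrix_(i, j) \sum_(k < n) L (mxtens_index (i, k)) (mxtens_index (j, k)).

(* For linear E and F, the linear map sending X *t Y to E X *t F Y: L is
   expanded in the basis of the delta_mx i j *t delta_mx k l. *)
Definition tens_map m n p q (E : 'M[C]_m -> 'M[C]_n) (F : 'M[C]_p -> 'M[C]_q)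
    (L : 'M[C]_(m * p)) : 'M[C]_(n * q) :=
  \sum_(i < m) \sum_(j < m) \sum_(k < p) \sum_(l < p)
    L (mxtens_index (i, k)) (mxtens_index (j, l)) *:
      (E (delta_mx i j) *t F (delta_mx k l)).

Definition completely_positive m n (E : 'M[C]_m -> 'M[C]_n) : Prop :=
  forall (k : nat) (L : 'M[C]_(k * m)),
    psdmx L -> psdmx (tens_map (@id 'M[C]_k) E L).

Definition cptp m n (E : 'M[C]_m -> 'M[C]_n) : Prop :=
  [/\ linear E, completely_positive E & forall X, \tr (E X) = \tr X].

Definition uconj n (V X : 'M[C]_n) : 'M[C]_n := V *m X *m V^t*.

Definition sub_povm n (X0 : finType) (M : X0 -> 'M[C]_n) : Prop :=
  (forall x, psdmx (M x)) /\ psdmx (1%:M - \sum_x M x).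

(* None plays the role of the additional outcome \perp. *)
Definition complete_povm n (X0 : finType) (M : X0 -> 'M[C]_n)
    (x : option X0) : 'M[C]_n :=
  if x is Some y then M y else 1%:M - \sum_y M y.

End Matrices.

(* The finite-dimensional systems under consideration. As is customary, (AB)C
   and A(BC), as well as A, 1A and A1, are the same system; the operators on A
   are the matrices of size hdim A. The Kronecker product being strictly
   associative and unital, this identification agrees with the one of the
   operator spaces. AB and BA are not identified. *)
Record systems : Type := Systems {
  sys :> Type;
  hdim : sys -> nat;
  sys1 : sys;
  sysM : sys -> sys -> sys;
  dim_gt0 : forall A, (0 < hdim A)%N;
  dim1 : hdim sys1 = 1%N;
  dimM : forall A B, hdim (sysM A B) = (hdim A * hdim B)%N;
  sysMA : forall A B D, sysM A (sysM B D) = sysM (sysM A B) D;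
  sys1M : forall A, sysM sys1 A = A;
  sysM1 : forall A, sysM A sys1 = A }.

Arguments sys1 {s}.

Section Systems.
Variables (R : realType) (Sys : systems).
Local Notation C := R[i].
Implicit Types A B D Q X : Sys.

Definition oper A : Type := 'M[C]_(hdim A).

Definition supermap A B : Type := oper A -> oper B.

Fixpoint spow A (n : nat) : Sys :=
  if n is m.+1 then sysM A (spow A m) else sys1.

Definition ojoin A B (L : 'M[C]_(hdim A * hdim B)) : oper (sysM A B) :=
  castmx (esym (dimM A B), esym (dimM A B)) L.

Definition osplit A B (L : oper (sysM A B)) : 'M[C]_(hdim A * hdim B) :=
  castmx (dimM A B, dimM A B) L.

Definition otens A B (X : oper A) (Y : oper B) : oper (sysM A B) :=
  ojoin (X *t Y).

Fixpoint opow A (X : oper A) (n : nat) : oper (spow A n) :=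
  match n return oper (spow A n) with
  | 0 => 1%:M
  | m.+1 => otens X (opow X m)
  end.

Definition stens A B A' B' (E : supermap A B) (F : supermap A' B') :
    supermap (sysM A A') (sysM B B') :=
  fun L => ojoin (tens_map E F (osplit L)).

Definition discard A X : supermap (sysM A X) A := fun L => ptrace2 (osplit L).

Definition discard_left Q B : supermap (sysM Q B) B :=
  fun L => ptrace1 (osplit L).

Record theory : Type := Theory {
  free_state : forall A, set (oper A);
  free_op : forall A B, set (supermap A B) }.

Arguments free_state : clear implicits.
Arguments free_op : clear implicits.

Definition resource_theory (T : theory) : Prop :=
  [/\ forall A, free_state T A `<=` @is_state R (hdim A),
      forall A B, free_op T A B `<=` @cptp R (hdim A) (hdim B),
      forall A B E rho,
        free_op T A B E -> free_state T A rho -> free_state T B (E rho),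
      forall A, free_op T A A id
    & forall A B D E F,
        free_op T A B E -> free_op T B D F -> free_op T A D (F \o E)].

Definition tensor_closed (T : theory) : Prop :=
  (forall A B rho sigma, free_state T A rho -> free_state T B sigma ->
     free_state T (sysM A B) (otens rho sigma)) /\
  (forall A B A' B' E F, free_op T A B E -> free_op T A' B' F ->
     free_op T (sysM A A') (sysM B B') (stens E F)).

Definition ancilla_preparation (T : theory) : Prop :=
  forall A X sigma, free_state T X sigma ->
    free_op T A (sysM A X) (fun rho => otens rho sigma).

Definition discard_closed (T : theory) : Prop :=
  forall A X, free_op T (sysM A X) A (@discard A X).

Definition convex_ops (T : theory) : Prop :=
  forall A B E F (p : R), free_op T A B E -> free_op T A B F -> 0 <= p <= 1 ->
    free_op T A B (fun L => p%:C *: E L + (1 - p)%:C *: F L).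

Section Symmetry.
Variable G : finGroupType.

Definition rep_family : Type := forall A, G -> oper A.

Definition projective_unitary_rep A (V : G -> oper A) : Prop :=
  (forall g, V g \is unitarymx) /\
  (forall g h, exists c : C,
     `|c| = 1 /\ V g *m V h = c *: V (g * h)%g).

Definition symmetry_rep (U : rep_family) : Prop :=
  (forall A, projective_unitary_rep (U A)) /\
  (forall A B g, U (sysM A B) g = otens (U A g) (U B g)).

Definition uact (U : rep_family) A (g : G) : supermap A A :=
  fun L => uconj (U A g) L.

Definition compatible (T : theory) (U : rep_family) : Prop :=
  (forall A g, uact U g @` free_state T A = free_state T A) /\
  (forall A B g,
     [set uact U g \o E \o uact U g^-1%g | E in free_op T A B] = free_op T A B).

Definition covariant (U : rep_family) A B (E : supermap A B) : Prop :=
  forall g, E \o uact U g = uact U g \o E.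

(* For x >= 0, Num.truncn x is the floor of x as a natural number. *)
Definition achievable (T : theory) (U : rep_family) A B
    (rho : oper A) (sigma : oper B) (r : R) : Prop :=
  0 <= r /\
  exists F : forall n : nat,
      supermap (spow A n) (spow B (Num.truncn (r * n%:R))),
    [/\ forall n, free_op T _ _ (F n),
        forall n, covariant U (F n)
      & (fun n : nat => trace_dist (F n (opow rho n))
                          (opow sigma (Num.truncn (r * n%:R)))) @ \oo
          --> (0 : R)].

Definition cov_rate (T : theory) (U : rep_family) A B
    (rho : oper A) (sigma : oper B) : \bar R :=
  ereal_sup [set r%:E | r in achievable T U rho sigma].

End Symmetry.

Definition control_admissible (T : theory) Q (X0 : finType)
    (M : X0 -> oper Q) : Prop :=
  forall B' C' (E : option X0 -> supermap B' C'),
    (forall x, free_op T B' C' (E x)) ->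
    free_op T (sysM Q B') C'
      (fun L => \sum_(x : option X0)
         E x (discard_left (otens (complete_povm M x) 1%:M *m L))).

End Systems.

Section Cosets.
Variables (G : finGroupType) (K : {group G}).

Definition left_coset : finType :=
  {x : {set G} | x \in lcosets K [set: G]%SET}.

Lemma lcoset_of_subproof (g : G) : (g *: K)%g \in lcosets K [set: G]%SET.
Proof. by apply/lcosetsP; exists g; rewrite ?inE. Qed.

Definition lcoset_of (g : G) : left_coset :=
  exist _ (g *: K)%g (lcoset_of_subproof g).

End Cosets.

(* Main.v *)
(* Fix 0 < s < r. Split the n copies of rho into l = floor((1 - s/r) n) and
   m = n - l copies. Measure the coset gK on the first l copies, apply
   U_g o E^(m) o U_g^-1 to the others for a representative g of the outcome, and
   discard the surplus copies of B; this is possible since r m >= s n. The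
   resulting free operation sends U_g(rho)^n close to U_g(sigma)^floor(s n) for
   every g: when the outcome is correct, the error is that of E^(m) on
   U_k(rho)^m for some k in K. Averaging the operation over its conjugates by G
   makes it covariant and, by unitary invariance and convexity of the trace
   distance, does not increase the error on rho. As both l and m tend to
   infinity, the error vanishes, so that s is achievable. *)
Require Import Defs.
From HB Require Import structures.
From mathcomp Require Import all_boot all_order all_algebra all_fingroup.
From mathcomp Require Import spectral sesquilinear.
From mathcomp Require Import all_classical all_reals all_analysis.
From mathcomp Require Import complex mxtens ring.

Set Implicit Arguments.
Unset Strict Implicit.
Unset Printing Implicit Defensive.

Import Order.TTheory GRing.Theory Num.Theory.
Import numFieldNormedType.Exports.

Local Open Scope classical_set_scope.
Local Open Scope ring_scope.

(** * Positive semidefinite matrices *)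

Section PositiveMatrices.
Local Open Scope sesquilinear_scope.
Local Open Scope complex_scope.
Variable R : realType.
Local Notation C := R[i].

Lemma adjmxM m n p (X : 'M[C]_(m, n)) (Y : 'M[C]_(n, p)) :
  (X *m Y)^t* = Y^t* *m X^t*.
Proof. by rewrite trmx_mul map_mxM. Qed.

Lemma hermsymmxP n (X : 'M[C]_n) : reflect (X^t* = X) (X \is hermsymmx).
Proof.
by apply: (iffP (is_hermitianmxP _ _ _)); rewrite expr0 scale1r => /esym.
Qed.

Lemma psdmx_herm n (X : 'M[C]_n) : psdmx X -> X^t* = X.
Proof. by case=> /hermsymmxP. Qed.

Lemma psdmx_conj m n (W : 'M[C]_(m, n)) X : psdmx X -> psdmx (W *m X *m W^t*).
Proof.
case=> /hermsymmxP hX pX; split.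
  by apply/hermsymmxP; rewrite !adjmxM trmxCK hX mulmxA.
by move=> v; have := pX (v *m W); rewrite adjmxM !mulmxA.
Qed.

Lemma psdmx1 n : psdmx (1%:M : 'M[C]_n).
Proof.
split; first exact: hermitian1mx_subproof.
move=> v; rewrite mulmx1 mxE sumr_ge0 // => i _.
by rewrite !mxE mul_conjC_ge0.
Qed.

Lemma psdmx_gram m n (W : 'M[C]_(m, n)) : psdmx (W^t* *m W).
Proof. by have := psdmx_conj (W^t* ) (psdmx1 m); rewrite mulmx1 trmxCK. Qed.

Lemma psdmx0 n : psdmx (0 : 'M[C]_n).
Proof. by have := psdmx_conj (0 : 'M[C]_n) (psdmx1 n); rewrite !mul0mx. Qed.

Lemma psdmxD n (X Y : 'M[C]_n) : psdmx X -> psdmx Y -> psdmx (X + Y).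
Proof.
move=> [/hermsymmxP hX pX] [/hermsymmxP hY pY]; split.
  by apply/hermsymmxP; rewrite linearD /= map_mxD hX hY.
by move=> v; rewrite mulmxDr mulmxDl mxE addr_ge0.
Qed.

Lemma psdmxZ n (X : 'M[C]_n) (c : C) : 0 <= c -> psdmx X -> psdmx (c *: X).
Proof.
move=> c0 [/hermsymmxP hX pX]; split.
  apply/hermsymmxP; rewrite linearZ /= map_mxZ hX; congr (_ *: _).
  exact/CrealP/ger0_real.
by move=> v; rewrite -scalemxAr -scalemxAl mxE mulr_ge0.
Qed.

Lemma psdmx_diag_ge0 n (X : 'M[C]_n) i : psdmx X -> 0 <= X i i.
Proof.
case=> _ /(_ (delta_mx 0 i)); rewrite -rowE.
rewrite mxE (bigD1 i) //= big1 ?addr0 => [|j /negPf ji]; last first.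
  by rewrite !mxE ji andbF conjC0 mulr0.
by rewrite !mxE !eqxx conjC1 mulr1.
Qed.

Lemma psdmx_tr_ge0 n (X : 'M[C]_n) : psdmx X -> 0 <= \tr X.
Proof. by move=> pX; apply: sumr_ge0 => i _; apply: psdmx_diag_ge0. Qed.

Lemma herm_spectral n (X : 'M[C]_n) (V := spectralmx X) (d := spectral_diag X) :
  X^t* = X -> [/\ V *m V^t* = 1%:M, V^t* *m V = 1%:M,
    X = V^t* *m diag_mx d *m V & forall i, d 0 i \is Num.real].
Proof.
move=> /hermsymmxP hX; have VU : V \is unitarymx by exact: spectral_unitarymx.
have VV : V *m V^t* = 1%:M by exact/unitarymxP.
split=> //; first exact: mulmx1C.
- have /orthomx_spectralP := hermitian_normalmx hX.
  by rewrite invmx_unitary.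
- by move=> i; have /mxOverP := hermitian_spectral_diag_real hX.
Qed.

Lemma diag_mxM n (d e : 'rV[C]_n) :
  diag_mx d *m diag_mx e = diag_mx (\row_i (d 0 i * e 0 i)).
Proof.
by apply/matrixP=> i j; rewrite mul_diag_mx !mxE; case: eqP => [->|];
  rewrite ?mulr1n ?mulr0n ?mulr0.
Qed.

Lemma adj_diag_mx n (d : 'rV[C]_n) : (forall i, d 0 i \is Num.real) ->
  (diag_mx d)^t* = diag_mx d.
Proof.
move=> dR; rewrite tr_diag_mx map_diag_mx; congr diag_mx.
by apply/rowP=> i; rewrite mxE; apply/CrealP.
Qed.

Lemma psdmx_diag n (d : 'rV[C]_n) : (forall i, 0 <= d 0 i) -> psdmx (diag_mx d).
Proof.
move=> d0; suff -> : diag_mx d = (diag_mx (\row_i sqrtC (d 0 i)))^t* *m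
    diag_mx (\row_i sqrtC (d 0 i)) by exact: psdmx_gram.
rewrite adj_diag_mx => [|i]; last by rewrite mxE ger0_real ?sqrtC_ge0.
rewrite diag_mxM; congr diag_mx; apply/rowP=> i; rewrite !mxE.
by rewrite -expr2 sqrtCK.
Qed.

(** With X = V^t* D V the spectral decomposition, W is the square root of D times V. The eigenvalues
    are nonnegative, being the diagonal entries of V X V^t*. *)
Lemma psdmx_gramP n (X : 'M[C]_n) :
  psdmx X -> exists W : 'M[C]_n, X = W^t* *m W.
Proof.
move=> pX; have [VV VV' XE dR] := herm_spectral (psdmx_herm pX).
set V := spectralmx X in VV VV' XE; set d := spectral_diag X in XE dR.
have d0 i : 0 <= d 0 i.
  have := psdmx_diag_ge0 i (psdmx_conj V pX).
  rewrite {1}XE !mulmxA VV mul1mx -mulmxA VV mulmx1.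
  by rewrite mxE eqxx mulr1n.
exists (diag_mx (\row_i sqrtC (d 0 i)) *m V).
rewrite adjmxM adj_diag_mx => [|i]; last by rewrite mxE ger0_real ?sqrtC_ge0.
rewrite mulmxA -[_ *m diag_mx _ *m diag_mx _]mulmxA diag_mxM {1}XE.
congr (_ *m diag_mx _ *m _); apply/rowP=> i; rewrite !mxE.
by rewrite -expr2 sqrtCK.
Qed.

(** Writing Y = W^t* W and using cyclicity turns the trace into that of the positive matrix W X
    W^t*. *)
Lemma psdmx_trM_ge0 n (X Y : 'M[C]_n) : psdmx X -> psdmx Y -> 0 <= \tr (X *m Y).
Proof.
move=> pX /psdmx_gramP[W ->]; rewrite mulmxA mxtrace_mulC mulmxA.
exact/psdmx_tr_ge0/psdmx_conj.
Qed.

Lemma adjmx_tens m n p q (X : 'M[C]_(m, n)) (Y : 'M[C]_(p, q)) :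
  (X *t Y)^t* = X^t* *t Y^t*.
Proof. by rewrite trmx_tens map_mxT. Qed.

Lemma psdmx_tens m n (X : 'M[C]_m) (Y : 'M[C]_n) :
  psdmx X -> psdmx Y -> psdmx (X *t Y).
Proof.
move=> /psdmx_gramP[V ->] /psdmx_gramP[W ->].
by rewrite -tensmx_mul -adjmx_tens; apply: psdmx_gram.
Qed.

Lemma mxtrace_tens m n (X : 'M[C]_m) (Y : 'M[C]_n) : \tr (X *t Y) = \tr X * \tr Y.
Proof. by rewrite /mxtrace mulr_sum; apply: eq_bigr => i _; rewrite mxE. Qed.

(** * Spectra and the trace norm of Hermitian matrices *)

Lemma prod_XsubC_perm n (a b : 'I_n -> C) :
  \prod_i ('X - (a i)%:P) = \prod_i ('X - (b i)%:P) ->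
  perm_eq [seq a i | i : 'I_n] [seq b i | i : 'I_n].
Proof.
have E (c : 'I_n -> C) :
    \prod_i ('X - (c i)%:P) = \prod_(x <- [seq c i | i : 'I_n]) ('X - x%:P).
  by rewrite big_map enumT.
by rewrite !E => /prod_XsubC_eq.
Qed.

Lemma char_poly_diag_conj n (V W : 'M[C]_n) (d : 'rV[C]_n) : V *m W = 1%:M ->
  char_poly (W *m diag_mx d *m V) = \prod_i ('X - (d 0 i)%:P).
Proof.
move=> VW; have WV := mulmx1C VW.
have detVW : \det (map_mx polyC W) * \det (map_mx polyC V) = 1.
  by rewrite -det_mulmx -map_mxM WV map_mx1 det1.
have -> : \prod_i ('X - (d 0 i)%:P) = char_poly (diag_mx d).
  rewrite char_poly_trig ?diag_mx_is_trig //.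
  by apply: eq_bigr => i _; rewrite mxE eqxx mulr1n.
rewrite /char_poly.
have -> : char_poly_mx (W *m diag_mx d *m V) =
    map_mx polyC W *m char_poly_mx (diag_mx d) *m map_mx polyC V.
  rewrite /char_poly_mx mulmxBr mulmxBl -!map_mxM; congr (_ - _).
  by rewrite scalar_mxC -mulmxA -map_mxM WV map_mx1 mulmx1.
by rewrite !det_mulmx mulrAC detVW mul1r.
Qed.

(** The chosen diagonalisation of X^t* X is unrelated to that of X, but the squares of the
    eigenvalues of X diagonalise the same matrix. Equal characteristic polynomials make the two
    spectra agree up to a permutation, which the sum does not see. *)
Lemma trace_norm_herm n (X : 'M[C]_n) : X^t* = X ->
  (trace_norm X)%:C = \sum_i `|spectral_diag X 0 i|.
Proof.
move=> hX; have [VV VV' XE dR] := herm_spectral hX.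
set V := spectralmx X in VV VV' XE; set d := spectral_diag X in XE dR *.
have hY : (X^t* *m X)^t* = X^t* *m X by rewrite adjmxM trmxCK.
have [WW WW' YE _] := herm_spectral hY; rewrite /trace_norm.
set W := spectralmx _ in WW WW' YE; set e := spectral_diag _ in YE *.
have YE' : X^t* *m X = V^t* *m diag_mx (\row_i (d 0 i * d 0 i)) *m V.
  rewrite hX {1 2}XE -diag_mxM !mulmxA; congr (_ *m _ *m _).
  by rewrite -[_ *m V *m _]mulmxA VV mulmx1.
have /prod_XsubC_perm/(perm_big _) pE : \prod_i ('X - (e 0 i)%:P) =
    \prod_i ('X - ((\row_i (d 0 i * d 0 i)) 0 i)%:P).
  by rewrite -(char_poly_diag_conj e WW) -YE YE' char_poly_diag_conj.
transitivity ((\sum_(x <- [seq e 0 i | i : 'I_n]) Num.sqrt (complex.Re x))%:C).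
  by rewrite big_map enumT.
rewrite pE big_map enumT rmorph_sum; apply: eq_bigr => i _.
rewrite mxE /=; have /complex_realP[x ->] := dR i.
by rewrite -rmorphM /= -expr2 sqrtr_sqr normc_def /= expr0n addr0 sqrtr_sqr.
Qed.

(* With trace_norm_decomp: for Hermitian X, the trace norm of X is the minimum of
   tr P + tr Q over the decompositions X = P - Q into positive matrices. *)
Lemma trace_norm_le n (P Q : 'M[C]_n) : psdmx P -> psdmx Q ->
  (trace_norm (P - Q))%:C <= \tr P + \tr Q.
Proof.
move=> pP pQ; set X := P - Q.
have hX : X^t* = X by rewrite linearB /= map_mxB !psdmx_herm.
rewrite trace_norm_herm //; have [VV VV' XE dR] := herm_spectral hX.
set V := spectralmx X in VV VV' XE; set d := spectral_diag X in XE dR *.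
have trV Y : \tr Y = \tr (V *m Y *m V^t*).
  by rewrite mxtrace_mulC mulmxA VV' mul1mx.
rewrite (trV P) (trV Q) -big_split /=; apply: ler_sum => i _.
(* In the eigenbasis of X each eigenvalue is a difference of diagonal entries of P and Q, both
   nonnegative, so its modulus is at most their sum. *)
have -> : d 0 i = (V *m P *m V^t*) i i - (V *m Q *m V^t*) i i.
  have -> : d 0 i = (diag_mx d) i i by rewrite mxE eqxx.
  have -> : diag_mx d = V *m X *m V^t*.
    by rewrite XE !mulmxA VV mul1mx -mulmxA VV mulmx1.
  by rewrite /X mulmxBr mulmxBl !mxE.
apply: le_trans (ler_normB _ _) _.
by rewrite !ger0_norm //; apply/psdmx_diag_ge0/psdmx_conj.
Qed.

Lemma trace_norm_decomp n (X : 'M[C]_n) : X^t* = X ->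
  exists P Q, [/\ psdmx P, psdmx Q, X = P - Q &
    (trace_norm X)%:C = \tr P + \tr Q].
Proof.
move=> hX; have [VV VV' XE dR] := herm_spectral hX.
rewrite trace_norm_herm //.
set V := spectralmx X in VV VV' XE; set d := spectral_diag X in XE dR *.
(* The positive and negative parts of the spectrum: p - q = d and p + q = |d|. *)
pose p : 'rV_n := \row_i (2^-1 * (`|d 0 i| + d 0 i)).
pose q : 'rV_n := \row_i (2^-1 * (`|d 0 i| - d 0 i)).
exists (V^t* *m diag_mx p *m V), (V^t* *m diag_mx q *m V).
have VK : V = V^t*^t* by rewrite trmxCK.
split.
- rewrite {2}VK; apply/psdmx_conj/psdmx_diag => i.
  rewrite mxE mulr_ge0 ?invr_ge0 ?ler0n // -[d 0 i]opprK subr_ge0.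
  by rewrite (le_trans (real_ler_norm _)) ?normrN ?realN.
- rewrite {2}VK; apply/psdmx_conj/psdmx_diag => i.
  by rewrite mxE mulr_ge0 ?invr_ge0 ?ler0n // subr_ge0 real_ler_norm.
- rewrite -mulmxBl -mulmxBr -linearB {1}XE; congr (_ *m diag_mx _ *m _).
  by apply/rowP=> i; rewrite !mxE; field.
- rewrite -!mulmxA !(mxtrace_mulC (V^t* )) -!mulmxA VV !mulmx1.
  rewrite !mxtrace_diag -big_split; apply: eq_bigr => i _ /=.
  by rewrite !mxE; field.
Qed.

Lemma trace_norm_ge0 n (X : 'M[C]_n) : 0 <= trace_norm X.
Proof. by apply: sumr_ge0 => i _; apply: sqrtr_ge0. Qed.

(** Optimal decompositions of X and Y add up to a decomposition of X + Y. *)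
Lemma trace_normD n (X Y : 'M[C]_n) : X^t* = X -> Y^t* = Y ->
  trace_norm (X + Y) <= trace_norm X + trace_norm Y.
Proof.
move=> /trace_norm_decomp[P [Q [pP pQ -> XE]]].
move=> /trace_norm_decomp[P' [Q' [pP' pQ' -> YE]]].
rewrite -lecR rmorphD /= XE YE addrACA -opprD.
apply: le_trans (trace_norm_le (psdmxD pP pP') (psdmxD pQ pQ')) _.
by rewrite !linearD /= addrACA.
Qed.

Lemma trace_normZ n (X : 'M[C]_n) (c : R) : X^t* = X -> 0 <= c ->
  trace_norm (c%:C *: X) <= c * trace_norm X.
Proof.
move=> /trace_norm_decomp[P [Q [pP pQ -> XE]]]; rewrite -ler0c => c0.
rewrite -lecR rmorphM /= XE scalerBr.
apply: le_trans (trace_norm_le (psdmxZ c0 pP) (psdmxZ c0 pQ)) _.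
by rewrite !linearZ /= mulrDr.
Qed.

Lemma trace_norm0 n : trace_norm (0 : 'M[C]_n) = 0.
Proof.
apply/le_anti; rewrite trace_norm_ge0 andbT -lecR.
by have := trace_norm_le (psdmx0 n) (psdmx0 n); rewrite subr0 mxtrace0 addr0.
Qed.

Lemma trace_norm_sum (I : Type) (s : seq I) (P : pred I) n (c : I -> R)
    (X : I -> 'M[C]_n) :
  (forall i, P i -> 0 <= c i) -> (forall i, (X i)^t* = X i) ->
  trace_norm (\sum_(i <- s | P i) (c i)%:C *: X i) <=
  \sum_(i <- s | P i) c i * trace_norm (X i).
Proof.
(* The induction carries Hermiticity of the partial sums along, as [trace_normD] asks for it. *)
move=> c0 hX; pose herm (Y : 'M[C]_n) := Y^t* = Y.
suff [] : herm (\sum_(i <- s | P i) (c i)%:C *: X i) /\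
  trace_norm (\sum_(i <- s | P i) (c i)%:C *: X i) <=
  \sum_(i <- s | P i) c i * trace_norm (X i) by [].
apply: (big_rec2 (fun Y b => herm Y /\ trace_norm Y <= b)) => [|i Y b Pi [hY Yb]].
  by rewrite trace_norm0; split=> //; rewrite /herm linear0 map_mx0.
have hcX : herm ((c i)%:C *: X i).
  rewrite /herm linearZ /= map_mxZ hX; congr (_ *: _).
  by apply/CrealP; rewrite ger0_real ?ler0c ?c0.
split; first by rewrite /herm linearD /= map_mxD hcX hY.
apply: le_trans (trace_normD hcX hY) _.
by apply: lerD Yb; apply: trace_normZ (hX i) (c0 i Pi).
Qed.

(** * Positive trace-preserving maps and the trace distance *)

Definition positive_tp m n (E : 'M[C]_m -> 'M[C]_n) :=
  [/\ linear E, forall X, psdmx X -> psdmx (E X) & forall X, \tr (E X) = \tr X].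

Lemma linear_mapB m n (E : 'M[C]_m -> 'M[C]_n) X Y :
  linear E -> E (X - Y) = E X - E Y.
Proof.
by move=> linE; rewrite addrC -scaleN1r linE scaleN1r addrC.
Qed.

(** E maps an optimal decomposition of X to a decomposition of E X with the same traces. Stating
    this for [positive_tp] covers channels and unitary conjugations at once. *)
Lemma trace_norm_contract m n (E : 'M[C]_m -> 'M[C]_n) X :
  positive_tp E -> X^t* = X -> trace_norm (E X) <= trace_norm X.
Proof.
move=> [linE posE trE] /trace_norm_decomp[P [Q [pP pQ -> XE]]].
rewrite -lecR XE linear_mapB // -(trE P) -(trE Q).
by apply: trace_norm_le; apply: posE.
Qed.

Lemma state_herm_sub n (X Y : 'M[C]_n) :
  is_state X -> is_state Y -> (X - Y)^t* = X - Y.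
Proof. by move=> [pX _] [pY _]; rewrite linearB /= map_mxB !psdmx_herm. Qed.

Lemma trace_norm_states n (X Y : 'M[C]_n) :
  is_state X -> is_state Y -> trace_norm (X - Y) <= 2.
Proof.
move=> [pX tX] [pY tY]; rewrite -lecR; apply: le_trans (trace_norm_le pX pY) _.
by rewrite tX tY rmorphMn /= rmorph1.
Qed.

Lemma uconj_positive_tp n (V : 'M[C]_n) : V \is unitarymx -> positive_tp (uconj V).
Proof.
move=> /unitarymxP VV; split=> [c X Y|X|X]; rewrite /uconj.
- by rewrite mulmxDr mulmxDl -scalemxAr -scalemxAl.
- exact: psdmx_conj.
- by rewrite mxtrace_mulC mulmxA (mulmx1C VV) mul1mx.
Qed.

Lemma linear_map_sum (V W : lmodType C) (E : V -> W) (I : Type) (s : seq I)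
    (P : pred I) (c : I -> C) (X : I -> V) : linear E ->
  E (\sum_(i <- s | P i) c i *: X i) = \sum_(i <- s | P i) c i *: E (X i).
Proof.
move=> linE; have E0 : E 0 = 0.
  by have := linE (-1) 0 0; rewrite scaleN1r oppr0 addr0 scaleN1r addNr.
apply: (big_rec2 (fun Y Z => E Y = Z)) => // i Y Z _ <-; exact: linE.
Qed.

Lemma linear_map_delta m n (E : 'M[C]_m -> 'M[C]_n) X : linear E ->
  E X = \sum_i \sum_j X i j *: E (delta_mx i j).
Proof.
move=> linE; rewrite {1}[X]matrix_sum_delta pair_big linear_map_sum //.
by rewrite pair_big.
Qed.

Lemma tens_map_tens m n p q (E : 'M[C]_m -> 'M[C]_n) (F : 'M[C]_p -> 'M[C]_q)
    X Y : linear E -> linear F -> tens_map E F (X *t Y) = E X *t F Y.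
Proof.
move=> linE linF; rewrite (linear_map_delta X linE) (linear_map_delta Y linF).
apply/matrixP=> a b; rewrite [RHS]mxE !summxE mulr_suml.
apply: eq_bigr => i _; rewrite !summxE mulr_suml.
apply: eq_bigr => j _; rewrite summxE mulr_sumr.
apply: eq_bigr => k _; rewrite !summxE mulr_sumr.
by apply: eq_bigr => l _; rewrite tensmxE !mxE mulrACA.
Qed.

Lemma psdmx_castmx m n (e : m = n) (X : 'M[C]_m) :
  psdmx (castmx (e, e) X) <-> psdmx X.
Proof. by case: n / e; rewrite castmx_id. Qed.

(** Complete positivity with a one-dimensional ancilla is positivity, up to a cast. *)
Lemma cptp_positive m n (E : 'M[C]_m -> 'M[C]_n) : cptp E -> positive_tp E.
Proof.
move=> [linE cpE trE]; split=> // X pX.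
have := cpE 1 _ (psdmx_tens (psdmx1 1) pX).
by rewrite tens_map_tens // tens_scalar1mx psdmx_castmx.
Qed.

Lemma positive_tp_state m n (E : 'M[C]_m -> 'M[C]_n) X :
  positive_tp E -> is_state X -> is_state (E X).
Proof. by move=> [_ posE trE] [pX tX]; split; rewrite ?trE //; apply: posE. Qed.

Lemma ptrace1_tens m n (X : 'M[C]_m) (Y : 'M[C]_n) :
  ptrace1 (X *t Y) = \tr X *: Y.
Proof.
apply/matrixP=> i j; rewrite !mxE mulr_suml.
by apply: eq_bigr => k _; rewrite tensmxE.
Qed.

Lemma ptrace2_tens m n (X : 'M[C]_m) (Y : 'M[C]_n) :
  ptrace2 (X *t Y) = \tr Y *: X.
Proof.
apply/matrixP=> i j; rewrite !mxE mulr_suml.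
by apply: eq_bigr => k _; rewrite tensmxE mulrC.
Qed.

Lemma trace_dist_contract m n (E : 'M[C]_m -> 'M[C]_n) X Y :
  positive_tp E -> is_state X -> is_state Y ->
  trace_dist (E X) (E Y) <= trace_dist X Y.
Proof.
move=> posE sX sY; rewrite /trace_dist ler_pM2l ?invr_gt0 ?ltr0n //.
have [linE _ _] := posE; rewrite -linear_mapB //.
exact/(trace_norm_contract posE)/state_herm_sub.
Qed.

Lemma trace_dist_le1 n (X Y : 'M[C]_n) :
  is_state X -> is_state Y -> trace_dist X Y <= 1.
Proof.
move=> sX sY; rewrite -(mulVf (_ : 2 != 0 :> R)) ?pnatr_eq0 //.
by rewrite ler_pM2l ?invr_gt0 ?ltr0n ?trace_norm_states.
Qed.

Lemma trace_dist_ge0 n (X Y : 'M[C]_n) : 0 <= trace_dist X Y.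
Proof. by rewrite mulr_ge0 ?invr_ge0 ?ler0n ?trace_norm_ge0. Qed.

(** Joint convexity, used for the mixture over measurement outcomes and again for the average over
    the group. *)
Lemma trace_dist_mix (I : finType) n (q : I -> R) (X Y : I -> 'M[C]_n) :
  (forall i, 0 <= q i) -> (forall i, is_state (X i)) ->
  (forall i, is_state (Y i)) ->
  trace_dist (\sum_i (q i)%:C *: X i) (\sum_i (q i)%:C *: Y i) <=
  \sum_i q i * trace_dist (X i) (Y i).
Proof.
move=> q0 sX sY; rewrite /trace_dist -sumrB.
under eq_bigr do rewrite -scalerBr.
under [leRHS]eq_bigr do rewrite mulrCA.
rewrite -mulr_sumr ler_pM2l ?invr_gt0 ?ltr0n //.
by apply: trace_norm_sum => // i; apply: state_herm_sub.
Qed.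

(** * Outcome probabilities of a completed sub-POVM *)

Section OutcomeProbabilities.
Variables (X0 : finType) (n : nat) (M : X0 -> 'M[C]_n) (X : 'M[C]_n).
Hypotheses (M_povm : sub_povm M) (X_state : is_state X).

(** Taking the real part loses nothing, by [outcome_probE]. *)
Definition outcome_prob (x : option X0) : R :=
  complex.Re (\tr (complete_povm M x *m X)).

Lemma sum_complete_povm : \sum_x complete_povm M x = 1%:M.
Proof.
rewrite (bigD1 None) //= (reindex_omap Some id) => [|[]//].
by under [X in _ + X]eq_bigl do rewrite eqxx; rewrite subrK.
Qed.

Lemma tr_complete_povm_ge0 x : 0 <= \tr (complete_povm M x *m X).
Proof.
have [[pM pM'] [pX _]] := (M_povm, X_state).
by apply: psdmx_trM_ge0 pX; case: x.
Qed.

Lemma outcome_probE x : (outcome_prob x)%:C = \tr (complete_povm M x *m X).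
Proof. by rewrite /outcome_prob RRe_real // ger0_real // tr_complete_povm_ge0. Qed.

Lemma outcome_prob_ge0 x : 0 <= outcome_prob x.
Proof. by rewrite -ler0c outcome_probE tr_complete_povm_ge0. Qed.

Lemma sum_outcome_prob : \sum_x outcome_prob x = 1.
Proof.
apply: complexI; rewrite rmorph_sum /=; under eq_bigr do rewrite outcome_probE.
by rewrite -raddf_sum /= -mulmx_suml sum_complete_povm mul1mx X_state.2.
Qed.

End OutcomeProbabilities.

End PositiveMatrices.

(** * Tensor powers and the identification of equal systems *)

Section TensorPowers.
Local Open Scope sesquilinear_scope.
Local Open Scope complex_scope.
Variables (R : realType) (Sys : systems).
Local Notation C := R[i].
Implicit Types A B D : Sys.

(** Transport along an equality of systems, expressed by [castmx] on dimensions so that entries can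
    be computed with [castmxE]. *)
Definition syscast A A' (e : A = A') : supermap R A A' :=
  castmx (congr1 (@hdim Sys) e, congr1 (@hdim Sys) e).

Lemma syscast_id A (e : A = A) (L : oper R A) : syscast e L = L.
Proof. by rewrite /syscast castmx_id. Qed.

Lemma syscast_comp A A' A'' (e : A = A') (e' : A' = A'') (L : oper R A) :
  syscast e' (syscast e L) = syscast (etrans e e') L.
Proof. by case: A'' / e'; rewrite syscast_id. Qed.

(* The proofs e and e' need not be equal, but the cast depends only on the
   equality of dimensions. *)
Lemma syscast_irr A A' (e e' : A = A') (L : oper R A) : syscast e L = syscast e' L.
Proof. by rewrite /syscast; congr (castmx (_, _) _); apply: eq_irrelevance. Qed.

(** Once the equality is eliminated, the cast is the identity channel. Regrouping copies is
    therefore free. *)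
Lemma free_syscast (T : theory R Sys) A A' (e : A = A') :
  resource_theory T -> free_op T (syscast e).
Proof.
case: A' / e => -[_ _ _ free_id _].
by have -> : syscast erefl = id :> supermap R A A by apply/funext/syscast_id.
Qed.

Lemma otens_syscastr A B B' (e : B = B') (X : oper R A) (Y : oper R B) :
  otens X (syscast e Y) = syscast (congr1 (sysM A) e) (otens X Y).
Proof. by case: B' / e; rewrite !syscast_id. Qed.

Lemma otensA A B D (X : oper R A) (Y : oper R B) (Z : oper R D) :
  syscast (sysMA A B D) (otens X (otens Y Z)) = otens (otens X Y) Z.
Proof.
apply/matrixP=> i j; rewrite !castmxE !mxE !castmxE !mxE mulrA.
(* A Kronecker index is a quotient and a remainder; both bracketings give the same three mixed-radix
   digits. *)
by congr (X _ _ * Y _ _ * Z _ _); apply: val_inj;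
  rewrite /= (dimM B D) ?modn_divl ?modn_dvdm ?dvdn_mull // mulnC divnMA.
Qed.

Lemma otens1 A (X : oper R A) :
  syscast (sys1M A) (otens (1%:M : oper R sys1) X) = X.
Proof.
have mx1E (a b : 'I_(hdim (@sys1 Sys))) : (1%:M : oper R sys1) a b = 1.
  rewrite mxE; suff -> : a = b by rewrite eqxx.
  by case: (hdim _) (dim1 Sys) a b => // -[] // _ a b; rewrite !ord1.
apply/matrixP=> i j; rewrite !castmxE mxE mx1E mul1r.
by congr (X _ _); apply: val_inj; rewrite /= modn_small.
Qed.

Lemma spowD A m n : sysM (spow A m) (spow A n) = spow A (m + n).
Proof. by elim: m => [|m IH] /=; rewrite ?sys1M // -sysMA IH. Qed.

Lemma opowD A (X : oper R A) m n :
  syscast (spowD A m n) (otens (opow X m) (opow X n)) = opow X (m + n).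
Proof.
elim: m => [|m IH] /=; first by rewrite -[RHS]otens1; apply: syscast_irr.
rewrite -[opow X (m + n)]IH otens_syscastr -otensA syscast_comp.
exact: syscast_irr.
Qed.

Lemma opowD_split A (X : oper R A) m n :
  syscast (esym (spowD A m n)) (opow X (m + n)) = otens (opow X m) (opow X n).
Proof. by rewrite -opowD syscast_comp syscast_id. Qed.

Lemma otens_mul A B (X X' : oper R A) (Y Y' : oper R B) :
  otens X Y *m otens X' Y' = otens (X *m X') (Y *m Y').
Proof.
rewrite /otens /ojoin -tensmx_mul; move: (X *t Y) (X' *t Y') => Z Z'.
(* With the matrices and the proof generalised, the dimension of the composite system can be
   replaced by the product, and the casts vanish. *)
by move: (esym (dimM A B)) => e; case: _ / e; rewrite !castmx_id.
Qed.

Lemma ojoinK A B : cancel (@ojoin R Sys A B) (@osplit R Sys A B).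
Proof. by move=> L; rewrite /osplit /ojoin castmx_comp castmx_id. Qed.

Lemma discard_otens A B (X : oper R A) (Y : oper R B) :
  discard (otens X Y) = \tr Y *: X.
Proof. by rewrite /discard ojoinK ptrace2_tens. Qed.

Lemma discard_left_otens A B (X : oper R A) (Y : oper R B) :
  discard_left (otens X Y) = \tr X *: Y.
Proof. by rewrite /discard_left ojoinK ptrace1_tens. Qed.

Lemma otens_state A B (X : oper R A) (Y : oper R B) :
  is_state X -> is_state Y -> is_state (otens X Y).
Proof.
move=> [pX tX] [pY tY]; split; first by rewrite psdmx_castmx; exact: psdmx_tens.
rewrite -(mulr1 1) -{1}tX -tY -mxtrace_tens /otens /ojoin.
by move: (X *t Y) (esym _) => Z e; case: _ / e; rewrite castmx_id.
Qed.

Lemma opow_state A (X : oper R A) n : is_state X -> is_state (opow X n).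
Proof.
move=> sX; elim: n => [|n IH] /=; last exact: otens_state.
by split; [exact: psdmx1 | rewrite mxtrace1 dim1].
Qed.

Lemma uconj_otens A B (V X : oper R A) (W Y : oper R B) :
  uconj (otens V W) (otens X Y) = otens (uconj V X) (uconj W Y).
Proof.
rewrite /uconj -!otens_mul; congr (_ *m _).
rewrite /otens /ojoin -adjmx_tens; move: (V *t W) (esym _) => Z e.
by case: _ / e; rewrite !castmx_id.
Qed.

(** * The symmetry action on operators *)

Variables (G : finGroupType) (U : rep_family R Sys G).
Hypothesis U_sym : symmetry_rep U.

Lemma unitary_rep A g : U A g \is unitarymx.
Proof. by case: U_sym => /(_ A)[+ _] _; apply. Qed.

Lemma uact_positive_tp A g : positive_tp (uact U (A := A) g).
Proof. exact/uconj_positive_tp/unitary_rep. Qed.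

Lemma uact_linear A g : linear (uact U (A := A) g).
Proof. by case: (uact_positive_tp A g). Qed.

Lemma opow_uact A (X : oper R A) g n :
  opow (uact U g X) n = uact U g (opow X n).
Proof.
elim: n => [|n IH] /=.
  (* Zero copies: the unitary on [sys1] may be any phase, but conjugation cancels it. *)
  by rewrite /uact /uconj mulmx1; apply/esym/unitarymxP/unitary_rep.
by rewrite IH /uact U_sym.2 uconj_otens.
Qed.

(** The phase c of the projective representation enters as c times its conjugate, which is 1; hence
    [uact] is a genuine action. *)
Lemma uact_comp A g h (X : oper R A) :
  uact U g (uact U h X) = uact U (g * h)%g X.
Proof.
have [c [c1 UgUh]] := (U_sym.1 A).2 g h.
rewrite /uact /uconj; transitivity (U A g *m U A h *m X *m (U A g *m U A h)^t*).
  by rewrite adjmxM !mulmxA.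
rewrite UgUh linearZ /= map_mxZ -!scalemxAl -scalemxAr scalerA.
by rewrite -[c * _]normCK c1 expr1n scale1r.
Qed.

(** The action of 1 is idempotent by [uact_comp] and injective by unitarity, so it is the
    identity. *)
Lemma uact1 A (X : oper R A) : uact U 1%g X = X.
Proof.
have inj : injective (uact U (A := A) 1%g).
  move=> Y Z; rewrite /uact /uconj => /(congr1 (fun L => (U A 1%g)^t* *m L *m U A 1%g)).
  have /unitarymxP/mulmx1C UU := unitary_rep A 1%g.
  by rewrite !mulmxA UU !mul1mx -!mulmxA UU !mulmx1.
by apply: inj; rewrite uact_comp mulg1.
Qed.

Lemma uactK A g (X : oper R A) : uact U g (uact U g^-1%g X) = X.
Proof. by rewrite uact_comp mulgV uact1. Qed.

Lemma uact_state A g (X : oper R A) : is_state X -> is_state (uact U g X).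
Proof. exact/positive_tp_state/uact_positive_tp. Qed.

(** * Averaging free operations over the group *)

Variable T : theory R Sys.
Hypothesis TU_compatible : compatible T U.
Hypothesis T_theory : resource_theory T.
Hypothesis T_convex : convex_ops T.

Lemma free_comp A B D (E : supermap R A B) (F : supermap R B D) :
  free_op T E -> free_op T F -> free_op T (F \o E).
Proof. by case: T_theory => _ _ _ _ +; apply. Qed.

Lemma free_positive_tp A B (E : supermap R A B) : free_op T E -> positive_tp E.
Proof. by case: T_theory => _ + _ _ _ => /[apply] /cptp_positive. Qed.

(** Compatibility provides freeness of the two-sided conjugate as a whole; the unitary actions
    themselves are not assumed free. *)
Lemma free_conj A B (E : supermap R A B) g :
  free_op T E -> free_op T (uact U g \o E \o uact U g^-1%g).
Proof. by move=> freeE; rewrite -(TU_compatible.2 A B g); exists E. Qed.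

(** Binary convexity is iterated along the list: the head gets weight 1 / (size s + 1) and the mean
    of the tail gets the rest. *)
Lemma free_mean A B (I : Type) (s : seq I) (E : I -> supermap R A B) :
  (0 < size s)%N -> (forall i, free_op T (E i)) ->
  free_op T (fun L => ((size s)%:R^-1)%:C *: \sum_(i <- s) E i L).
Proof.
move=> + freeE; elim: s => // i s IH _.
have [s0|s_gt0] := posnP (size s).
  rewrite (size0nil s0) (_ : (fun L => _) = E i) //.
  by apply/funext => L; rewrite big_seq1 invr1 scale1r.
have sR : (size s)%:R + 1 != 0 :> R by rewrite natr1 pnatr_eq0.
have sR' : (size s)%:R != 0 :> R by rewrite pnatr_eq0 -lt0n.
rewrite (_ : (fun L => _) = (fun L => ((size s).+1%:R^-1)%:C *: E i L +
    (1 - (size s).+1%:R^-1)%:C *: (((size s)%:R^-1)%:C *: \sum_(i <- s) E i L))).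
  by apply: T_convex (IH s_gt0) _ => //; rewrite invr_ge0 ler0n invf_le1 ?ler1n ?ltr0n.
apply/funext=> L; rewrite big_cons scalerDr scalerA -rmorphM /=.
by congr (_ + _%:C *: _); rewrite -natr1; field; apply/andP.
Qed.

Definition twirl A B (F : supermap R A B) : supermap R A B :=
  fun L => (#|G|%:R^-1)%:C *: \sum_g uact U g (F (uact U g^-1%g L)).

Lemma card_group_gt0 : (0 < #|G|)%N.
Proof. by apply/card_gt0P; exists 1%g. Qed.

Lemma free_twirl A B (F : supermap R A B) : free_op T F -> free_op T (twirl F).
Proof.
move=> freeF; have sz : size (index_enum G) = #|G| by rewrite cardT enumT.
have := @free_mean A B _ (index_enum G)
  (fun g => uact U g \o F \o uact U g^-1%g).
by rewrite sz => /(_ card_group_gt0); apply=> g; apply: free_conj.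
Qed.

(** Replacing g by h g in the average turns U_g F U_(g^-1) U_h into U_h U_g F U_(g^-1). *)
Lemma covariant_twirl A B (F : supermap R A B) : covariant U (twirl F).
Proof.
move=> h; apply/funext=> L; rewrite /twirl /= !scaler_sumr.
rewrite linear_map_sum; last exact: uact_linear.
rewrite (reindex_inj (mulgI h)); apply: eq_bigr => g _ /=.
by rewrite !uact_comp invMg mulgKV.
Qed.

End TensorPowers.

(** * The covariant operation for finitely many copies *)

Section OneShot.
Local Open Scope sesquilinear_scope.
Local Open Scope complex_scope.
Variables (R : realType) (Sys : systems) (G : finGroupType).
Variables (T : theory R Sys) (U : rep_family R Sys G).
Hypotheses (T_theory : resource_theory T) (T_discard : discard_closed T).
Hypotheses (T_convex : convex_ops T) (U_sym : symmetry_rep U).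
Hypothesis TU_compatible : compatible T U.
Variables (A B : Sys) (rho : oper R A) (sigma : oper R B) (K : {group G}).
Hypotheses (rho_state : is_state rho) (sigma_state : is_state sigma).
Local Notation C := R[i].

Lemma discard_pow D k k' : (k <= k')%N ->
  exists E : supermap R (spow D k') (spow D k), free_op T E /\
    forall X, is_state X -> E (opow X k') = opow X k.
Proof.
move=> /subnKC <-; set j := (k' - k)%N.
exists (@discard R Sys (spow D k) (spow D j) \o syscast (esym (spowD D k j))).
split; first exact: free_comp (free_syscast _ _) (T_discard _ _).
move=> X sX /=; rewrite opowD_split discard_otens.
by case: (opow_state j sX) => _ ->; rewrite scale1r.
Qed.

Definition coset_rep (x : left_coset K) : G := repr (val x).

(** Undoing the representative c instead of the unknown g leaves the element c^-1 g of K, on which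
    the given operation is controlled. *)
Lemma coset_repP g : ((coset_rep (lcoset_of K g))^-1 * g)%g \in K.
Proof.
have : coset_rep (lcoset_of K g) \in (g *: K)%g.
  by apply: mem_repr (lcoset_refl K g).
by rewrite mem_lcoset => /groupVr; rewrite invMg invgK.
Qed.

Variables (l m k k' : nat).
Hypothesis kk' : (k <= k')%N.
Variable M : left_coset K -> oper R (spow A l).
Hypotheses (M_povm : sub_povm M) (M_control : control_admissible T M).
Variable E : supermap R (spow A m) (spow B k').
Hypothesis free_E : free_op T E.

(** The errors are sums rather than averages over G and K: a sum of nonnegative terms dominates each
    term, giving a bound uniform in the group element. *)
Lemma covariant_one_shot :
  exists F : supermap R (spow A (l + m)) (spow B k),
    [/\ free_op T F, covariant U F &
    trace_dist (F (opow rho (l + m))) (opow sigma k) <=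
    \sum_g (1 - complex.Re (\tr (M (lcoset_of K g) *m opow (uact U g rho) l))) +
    \sum_(h in K) trace_dist (E (opow (uact U h rho) m)) (opow (uact U h sigma) k')].
Proof.
set delta := _ + _.
have [D [free_D DE]] := discard_pow B kk'.
pose E1 := D \o E.
have free_E1 : free_op T E1 := free_comp T_theory free_E free_D.
(* The inconclusive outcome [None] runs plain [E1]; it is counted as a failure below. *)
pose Ex x : supermap R (spow A m) (spow B k) :=
  if x is Some c then uact U (coset_rep c) \o E1 \o uact U (coset_rep c)^-1%g
  else E1.
have free_Ex x : free_op T (Ex x) by case: x => [c|] //; exact: free_conj.
pose F0 := (fun L => \sum_x Ex x (discard_left (otens (complete_povm M x) 1%:M *m L)))
  \o syscast (esym (spowD A l m)).
have free_F0 : free_op T F0.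
  exact: free_comp (free_syscast _ _) (M_control free_Ex).
have rho_st g n : is_state (opow (uact U g rho) n).
  by apply/opow_state/uact_state.
have sigma_st g n : is_state (opow (uact U g sigma) n).
  by apply/opow_state/uact_state.
(* On a tensor power the measured block factors out, so F0 acts as a mixture of the Ex weighted by
   the outcome probabilities. *)
have F0E X : is_state X -> F0 (opow X (l + m)) =
    \sum_x (outcome_prob M (opow X l) x)%:C *: Ex x (opow X m).
  move=> sX; rewrite /F0 /= opowD_split; apply: eq_bigr => x _.
  rewrite otens_mul mul1mx discard_left_otens.
  rewrite -(outcome_probE M_povm (opow_state l sX)).
  have [linE _ _] := free_positive_tp T_theory (free_Ex x).
  (* The one-element sum is homogeneity of [Ex x]. *)
  have := @linear_map_sum R _ _ (Ex x) unit [:: tt] predT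
    (fun=> (outcome_prob M (opow X l) x)%:C) (fun=> opow X m) linE.
  by rewrite !big_seq1.
pose p g := complex.Re (\tr (M (lcoset_of K g) *m opow (uact U g rho) l)).
have p_le1 g : p g <= 1.
  rewrite -(sum_outcome_prob M_povm (rho_st g l)) (bigD1 (Some (lcoset_of K g))) //=.
  rewrite lerDl sumr_ge0 // => x _.
  exact: outcome_prob_ge0.
have E1_dist h : h \in K ->
    trace_dist (E1 (opow (uact U h rho) m)) (opow (uact U h sigma) k) <=
    \sum_(h in K) trace_dist (E (opow (uact U h rho) m)) (opow (uact U h sigma) k').
  move=> hK; rewrite (bigD1 h) //=; apply: ler_wpDr.
    by apply: sumr_ge0 => ? _; apply: trace_dist_ge0.
  rewrite -(DE (uact U h sigma)); last exact: uact_state.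
  apply: trace_dist_contract => //; first exact: free_positive_tp free_D.
  exact: positive_tp_state (free_positive_tp T_theory free_E) _.
have F0_dist g : trace_dist (F0 (opow (uact U g rho) (l + m)))
    (opow (uact U g sigma) k) <= delta.
  rewrite F0E; last exact: uact_state.
  set q := outcome_prob M _; set Y := opow _ m; set S := opow _ k.
  have q0 x : 0 <= q x by exact: outcome_prob_ge0.
  have q1 : \sum_x q x = 1 := sum_outcome_prob M_povm (rho_st g l).
  (* The target is written with the same weights so that joint convexity applies. *)
  have -> : S = \sum_x (q x)%:C *: S.
    by rewrite -scaler_suml -rmorph_sum q1 scale1r.
  have sEx x : is_state (Ex x Y).
    exact: positive_tp_state (free_positive_tp T_theory (free_Ex x)) (rho_st g m).
  apply: le_trans (trace_dist_mix q0 sEx (fun=> sigma_st g k)) _.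
  pose x0 := Some (lcoset_of K g).
  (* Wrong outcomes have total weight 1 - p g and distance at most 1; the correct outcome has weight
     at most 1 and is left to [E1_dist]. *)
  rewrite (bigD1 x0) //= addrC; apply: lerD.
    apply: (@le_trans _ _ (1 - p g)); last first.
      rewrite (bigD1 g) //= lerDl sumr_ge0 // => h _.
      by rewrite subr_ge0; apply: p_le1.
    rewrite -q1 [\sum_x q x](bigD1 x0) //= -[p g]/(q x0) addrAC subrr add0r.
    by apply: ler_sum => x _; rewrite ler_piMr ?trace_dist_le1.
  apply: (@le_trans _ _ (trace_dist (Ex x0 Y) S)).
    by rewrite ler_piMl ?trace_dist_ge0 // p_le1.
  rewrite /x0 /=; set c := coset_rep _; have cK := coset_repP g.
  apply: le_trans (E1_dist _ cK).
  rewrite -(uact_comp U_sym c^-1%g g rho) -(uact_comp U_sym c^-1%g g sigma).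
  rewrite (opow_uact U_sym (uact U g rho)) (opow_uact U_sym (uact U g sigma)).
  rewrite -/Y -/S.
  (* With S written as U_c applied to U_(c^-1) S, the outer U_c is common to both arguments and is
     removed by contractivity. *)
  rewrite -{1}(uactK U_sym c S).
  apply: trace_dist_contract; first exact: uact_positive_tp.
  - apply: positive_tp_state (free_positive_tp T_theory free_E1) _.
    exact: uact_state (rho_st g m).
  - exact: uact_state (sigma_st g k).
exists (twirl U F0); split; [exact: free_twirl|exact: covariant_twirl|].
rewrite /twirl scaler_sumr.
have G0 : #|G|%:R != 0 :> R by rewrite pnatr_eq0 -lt0n card_group_gt0.
have mean c : \sum_(g : G) #|G|%:R^-1 * c = c :> R.
  by rewrite -mulr_sumr sumr_const -[c *+ _]mulr_natl mulKf.
(* The target and then the bound are spread over G, so that the twirl is compared term by term. *)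
have -> : opow sigma k = \sum_(g : G) (#|G|%:R^-1)%:C *: opow sigma k.
  rewrite -scaler_suml -rmorph_sum.
  by under eq_bigr do rewrite -[_^-1]mulr1; rewrite mean scale1r.
apply: le_trans (trace_dist_mix _ _ _) _.
- by move=> g; rewrite invr_ge0 ler0n.
- move=> g; apply/uact_state => //.
  apply: positive_tp_state (free_positive_tp T_theory free_F0) _.
  by apply/uact_state => //; apply: opow_state.
- by move=> g; apply: opow_state.
rewrite -(mean delta); apply: ler_sum => g _.
rewrite ler_wpM2l ?invr_ge0 ?ler0n //.
(* The g-th conjugate feeds U_(g^-1) of the input to F0, and its outer U_g is cancelled against the
   invariant form of the target. *)
apply: le_trans (F0_dist g^-1%g).
rewrite (opow_uact U_sym rho) (opow_uact U_sym sigma).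
rewrite -{1}(uactK U_sym g (opow sigma k)).
apply: trace_dist_contract; first exact: uact_positive_tp.
- apply: positive_tp_state (free_positive_tp T_theory free_F0) _.
  by apply/uact_state => //; apply: opow_state.
- by apply/uact_state => //; apply: opow_state.
Qed.

End OneShot.

(** * The limit of many copies *)

Lemma truncn_mul_cvgn (R : realType) (a : R) : 0 < a ->
  (fun n : nat => Num.truncn (a * n%:R)) @ \oo --> \oo.
Proof.
move=> a0; apply/cvgnyPge => N; near=> n.
rewrite truncn_ge_nat ?mulr_ge0 ?ler0n ?(ltW a0) // mulrC -ler_pdivrMr //.
by near: n; exact: nbhs_infty_ger.
Unshelve. all: by end_near. Qed.

Lemma achievable_lt (R : realType) (Sys : systems) (G : finGroupType)
    (T : theory R Sys) (U : rep_family R Sys G)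
    (T_theory : resource_theory T) (T_discard : discard_closed T)
    (T_convex : convex_ops T)
    (U_sym : symmetry_rep U) (TU_compatible : compatible T U)
    (A B : Sys) (rho : oper R A) (sigma : oper R B)
    (rho_state : is_state rho) (sigma_state : is_state sigma)
    (K : {group G}) (r s : R) :
  (exists E : forall n : nat,
       supermap R (spow A n) (spow B (Num.truncn (r * n%:R))),
     (forall n, free_op T (E n)) /\
     (fun n : nat => #|K|%:R^-1 *
        \sum_(k in K) trace_dist (E n (opow (uact U k rho) n))
           (opow (uact U k sigma) (Num.truncn (r * n%:R)))) @ \oo
       --> (0 : R)) ->
  (exists M : forall l : nat, left_coset K -> oper R (spow A l),
     [/\ forall l, sub_povm (M l),
         forall l, control_admissible T (M l)
       & (fun l : nat => #|G|%:R^-1 *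
            \sum_(g : G) complex.Re
              (\tr (M l (lcoset_of K g) *m opow (uact U g rho) l))) @ \oo
           --> (1 : R)]) ->
  0 < s < r -> achievable T U rho sigma s.
Proof.
move=> [E [free_E E_cvg]] [M [M_povm M_control M_cvg]] /andP[s0 sr].
have r0 : 0 < r := lt_trans s0 sr.
split; first exact: ltW.
(* These are |K| times the average error of E and |G| times the average failure probability of M;
   the factors are constant, so both still vanish. *)
pose dE n := \sum_(k in K) trace_dist (E n (opow (uact U k rho) n))
  (opow (uact U k sigma) (Num.truncn (r * n%:R))).
pose dM l := \sum_(g : G)
  (1 - complex.Re (\tr (M l (lcoset_of K g) *m opow (uact U g rho) l))).
have dE_cvg : dE @ \oo --> (0 : R).
  have K0 : #|K|%:R != 0 :> R by rewrite pnatr_eq0 -lt0n cardG_gt0.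
  rewrite -(mulr0 #|K|%:R).
  rewrite (_ : dE = fun n => #|K|%:R * (#|K|%:R^-1 * dE n)); first exact: cvgMr.
  by apply/funext=> n; rewrite mulVKf.
have dM_cvg : dM @ \oo --> (0 : R).
  have G0 : #|G|%:R != 0 :> R by rewrite pnatr_eq0 -lt0n card_group_gt0.
  rewrite -(mulr0 #|G|%:R) -(subrr 1).
  rewrite (_ : dM = fun l => #|G|%:R * (1 - #|G|%:R^-1 * \sum_(g : G) complex.Re
      (\tr (M l (lcoset_of K g) *m opow (uact U g rho) l)))).
    by apply: cvgMr; apply: cvgB => //; apply: cvg_cst.
  apply/funext=> l; rewrite mulrBr mulr1 mulVKf // /dM sumrB.
  by rewrite sumr_const.
(* The fraction of copies kept for conversion, chosen so that r b = s. *)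
pose b := s / r.
have b01 : 0 < b < 1 by rewrite divr_gt0 //= ltr_pdivrMr // mul1r.
have /andP[b0 b1] := b01.
have [c0 c1] : 0 < 1 - b /\ 1 - b <= 1 by rewrite subr_gt0 lerBlDr lerDl ltW.
pose l n := Num.truncn ((1 - b) * n%:R).
pose m n := (n - l n)%N.
(* Rounding the measured block down makes the remaining block at least b n with no loss, so that r m
   >= s n for every n. *)
have l_real n : (l n)%:R <= (1 - b) * n%:R by rewrite truncn_le mulr_ge0 // ltW.
have l_le n : (l n <= n)%N.
  by rewrite -(ler_nat R) (le_trans (l_real n)) // ler_piMl.
have m_ge n : b * n%:R <= (m n)%:R.
  by rewrite natrB // lerBrDl -lerBrDr -[X in X - _]mul1r -mulrBl.
have l_cvg : l @ \oo --> \oo by exact: truncn_mul_cvgn.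
have m_cvg : m @ \oo --> \oo.
  apply/cvgnyPge => N; near=> n; apply: (@leq_trans (Num.truncn (b * n%:R))).
    by near: n; move: N; apply/cvgnyPge/truncn_mul_cvgn.
  by rewrite -(ler_nat R) (le_trans _ (m_ge n)) // truncn_le mulr_ge0 // ltW.
have exF n : exists F : supermap R (spow A n) (spow B (Num.truncn (s * n%:R))),
    [/\ free_op T F, covariant U F &
    trace_dist (F (opow rho n)) (opow sigma (Num.truncn (s * n%:R))) <=
    dM (l n) + dE (m n)].
  have kk' : (Num.truncn (s * n%:R) <= Num.truncn (r * (m n)%:R))%N.
    apply: le_truncn; apply: le_trans (ler_wpM2l (ltW r0) (m_ge n)).
    by rewrite mulrA /b mulrCA mulfV ?mulr1 // gt_eqF.
  have := covariant_one_shot T_theory T_discard T_convex U_sym TU_compatible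
    rho_state sigma_state kk' (M_povm (l n)) (M_control (l n)) (free_E (m n)).
  by rewrite -/(dM (l n)) -/(dE (m n)) /m subnKC.
(* Choice turns the existence for each n into a sequence. *)
pose F n := projT1 (cid (exF n)).
have FP n := projT2 (cid (exF n)).
exists F; split=> [n|n|]; try by case: (FP n).
apply: (@squeeze_cvgr _ _ _ _ (cst 0) (fun n => dM (l n) + dE (m n))).
- by near=> n; rewrite trace_dist_ge0; case: (FP n).
- exact: cvg_cst.
- rewrite -(addr0 0); apply: cvgD.
    exact: (cvg_comp l dM l_cvg dM_cvg).
  exact: (cvg_comp m dE m_cvg dE_cvg).
Unshelve. all: by end_near. Qed.

Theorem theorem4 (R : realType) (Sys : systems) (G : finGroupType)
    (T : theory R Sys) (U : rep_family R Sys G)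
    (T_theory : resource_theory T) (T_tensor : tensor_closed T)
    (T_ancilla : ancilla_preparation T) (T_discard : discard_closed T)
    (T_convex : convex_ops T)
    (U_sym : symmetry_rep U) (TU_compatible : compatible T U)
    (A B : Sys) (rho : oper R A) (sigma : oper R B)
    (rho_state : is_state rho) (sigma_state : is_state sigma)
    (K : {group G}) (r : R) (r_gt0 : 0 < r) :
  (exists E : forall n : nat,
       supermap R (spow A n) (spow B (Num.truncn (r * n%:R))),
     (forall n, free_op T (E n)) /\
     (fun n : nat => #|K|%:R^-1 *
        \sum_(k in K) trace_dist (E n (opow (uact U k rho) n))
           (opow (uact U k sigma) (Num.truncn (r * n%:R)))) @ \oo
       --> (0 : R)) ->
  (exists M : forall l : nat, left_coset K -> oper R (spow A l),
     [/\ forall l, sub_povm (M l),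
         forall l, control_admissible T (M l)
       & (fun l : nat => #|G|%:R^-1 *
            \sum_(g : G) complex.Re
              (\tr (M l (lcoset_of K g) *m opow (uact U g rho) l))) @ \oo
           --> (1 : R)]) ->
  (r%:E <= cov_rate T U rho sigma)%E.
Proof.
move=> hE hM; apply/lee_subgt0Pr => e e0.
(* The rate r is approached from below; r / 2 keeps s positive when e >= r. *)
pose s := Num.max (r - e) (r / 2).
have s_bounds : 0 < s < r.
  rewrite lt_max gt_max divr_gt0 //= orbT ltrBlDr ltrDl e0 /=.
  by rewrite ltr_pdivrMr // ltr_pMr // ltr1n.
apply: (@le_trans _ _ s%:E); first by rewrite lee_fin le_max lexx.
by apply: ereal_sup_ubound; exists s => //; apply: (achievable_lt _ _ _ _ _ _ _ hE hM).
Qed.
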